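(* Let $D,M\ge 1$ be integers, and let $\mathcal{C}\subseteq\{0,1\}^D$ be a finite nonempty collection of binary vectors each having at most $M$ nonzeros. Let $0<S_0\le M$ and $0<c<1$. Then minwise hashing on $\{1,\dots,D+2M\}$, together with the query transformation $Q''$ and preprocessing transformation $P''$ defined in the context, is an $\left(S_0,cS_0,\frac{S_0}{2M-S_0},\frac{cS_0}{2M-cS_0}\right)$-sensitive asymmetric hashing family for set intersection (binary inner product). That is, for every query $q\in\{0,1\}^D$ with at most $M$ nonzeros and every $x\in\mathcal{C}$, - if $q^Tx\ge S_0$ then $\Pr_\pi\big(h_\pi(Q''(q))=h_\pi(P''(x))\big)\ge\frac{S_0}{2M-S_0}$; - if $q^Tx\le cS_0$ then $\Pr_\pi\big(h_\pi(Q''(q))=h_\pi(P''(x))\big)\le\frac{cS_0}{2M-cS_0}$.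
   Context: Binary vectors in $\{0,1\}^n$ are identified with subsets of $\{1,\dots,n\}$ (the positions of the ones). For a binary vector $x$, $f_x$ denotes its number of nonzeros. $[\,\cdot\,;\,\cdot\,]$ denotes concatenation. Transformations $P'',Q'':\{0,1\}^D\to\{0,1\}^{D+2M}$, defined on vectors with at most $M$ nonzeros: $P''(x)$ is $x$ followed by $M-f_x$ ones and then $M+f_x$ zeros; $Q''(x)$ is $x$ followed by $M$ zeros, then $M-f_x$ ones, then $f_x$ zeros. Minwise hashing: $\pi$ is a uniformly random permutation of $\{1,\dots,D+2M\}$ and $h_\pi(z)=\min\{\pi(j):j\in z\}$ for a nonempty subset $z$ of $\{1,\dots,D+2M\}$. *)

(* Defs.v *)
From mathcomp Require Import all_boot all_order all_algebra all_fingroup.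
Set Implicit Arguments.
Unset Strict Implicit.
Unset Printing Implicit Defensive.
Import Order.TTheory GRing.Theory Num.Theory.

Definition nnz (D : nat) (x : D.-tuple bool) : nat := count id x.

Definition binary_inner (D : nat) (x y : D.-tuple bool) : nat :=
  \sum_(i < D) tnth x i * tnth y i.

Definition sparse_vec (D M : nat) : Type := {x : D.-tuple bool | nnz x <= M}.

Definition vec (D M : nat) (x : sparse_vec D M) : D.-tuple bool := val x.

Lemma preproc_sizeP (D M : nat) (x : sparse_vec D M) :
  size (vec x ++ nseq (M - nnz (vec x)) true ++ nseq (M + nnz (vec x)) false)
    == D + 2 * M.
Proof.
by rewrite !size_cat !size_nseq size_tuple (addnCA (_ - _)) subnK ?(valP x) // mul2n addnn.
Qed.

Lemma query_sizeP (D M : nat) (x : sparse_vec D M) :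
  size (vec x ++ nseq M false ++ nseq (M - nnz (vec x)) true
          ++ nseq (nnz (vec x)) false) == D + 2 * M.
Proof. by rewrite !size_cat !size_nseq size_tuple subnK ?(valP x) // mul2n addnn. Qed.

Definition preproc (D M : nat) (x : sparse_vec D M) : (D + 2 * M).-tuple bool :=
  Tuple (preproc_sizeP x).

Definition query_transf (D M : nat) (x : sparse_vec D M) :
    (D + 2 * M).-tuple bool :=
  Tuple (query_sizeP x).

Definition support_set (N : nat) (z : N.-tuple bool) : {set 'I_N} :=
  [set j | tnth z j].

(* Positions and ranks are 0-based.  On a nonempty [z] the default [N] is
   irrelevant, since every [pi j] is smaller than [N]. *)
Definition minhash (N : nat) (pi : 'S_N) (z : N.-tuple bool) : nat :=
  \big[minn/N]_(j in support_set z) pi j.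

Local Open Scope ring_scope.

Definition uniform_pr (R : realFieldType) (Omega : finType)
    (E : {set Omega}) : R :=
  #|E|%:R / #|Omega|%:R.

(* The hash functions [h w : W -> U] are indexed by a uniformly random [w];
   [Q] is applied to queries and [P] to the elements of the collection [C]. *)
Definition asymmetric_sensitive (R : realFieldType) (X : finType) (W : Type)
    (U : eqType) (Omega : finType) (sim : X -> X -> R) (h : Omega -> W -> U)
    (Q P : X -> W) (C : {set X}) (S0 S1 p1 p2 : R) : Prop :=
  forall q x : X, x \in C ->
    let pr := uniform_pr R [set w : Omega | h w (Q q) == h w (P x)] in
    (S0 <= sim q x -> p1 <= pr) /\ (sim q x <= S1 -> pr <= p2).

(* Main.v *)
(** The tail blocks pad both transformed sets to exactly [M] elements, and the
    two paddings occupy disjoint positions, so the transformed sets meet in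
    [a = q^T x] elements and their union has [2M - a].  The element of the union
    with the smallest rank is uniformly distributed, and the two hashes agree
    iff it lies in the intersection; the collision probability is therefore
    [a / (2M - a)], which increases with [a]. *)
Require Import Defs.
From mathcomp Require Import all_boot all_order all_algebra all_fingroup.
From mathcomp Require Import zify lra.
Set Implicit Arguments.
Unset Strict Implicit.
Unset Printing Implicit Defensive.
Import Order.TTheory GRing.Theory Num.Theory.
Local Open Scope ring_scope.

(** * Uniformity of the element of smallest rank in a fixed set *)

Section CollisionCount.
Local Open Scope nat_scope.
Variables (N : nat) (U : {set 'I_N}) (j0 : 'I_N).
Hypothesis Uj0 : j0 \in U.

(** [j0] only witnesses that [U] is nonempty: since [s] is injective, the minimiser is unique and
    does not depend on this choice. *)
Definition first_elt (s : 'S_N) : 'I_N := [arg min_(j < j0 in U) s j].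

Lemma first_eltP (s : 'S_N) (j : 'I_N) :
  reflect (j \in U /\ forall i, i \in U -> s j <= s i) (first_elt s == j).
Proof.
rewrite /first_elt; case: arg_minnP => // k Uk kmin.
apply: (iffP eqP) => [<- //|[Uj jmin]].
apply: (@perm_inj _ s); apply: val_inj; apply/eqP.
by rewrite eqn_leq kmin ?jmin.
Qed.

Lemma first_elt_in (s : 'S_N) : first_elt s \in U.
Proof. by have /first_eltP[] := eqxx (first_elt s). Qed.

Lemma first_elt_le (s : 'S_N) (i : 'I_N) : i \in U -> s (first_elt s) <= s i.
Proof. by have /first_eltP[_] := eqxx (first_elt s); apply. Qed.

Lemma first_elt_tperm (s : 'S_N) (j k : 'I_N) :
  j \in U -> k \in U -> first_elt s = j -> first_elt (tperm j k * s) = k.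
Proof.
move=> Uj Uk /eqP/first_eltP[_ jmin]; apply/eqP/first_eltP; split=> // i Ui.
by rewrite !permM tpermR; case: tpermP => [_|_|_ _]; apply: jmin.
Qed.

(** Left multiplication by [tperm j k] exchanges the ranks of [j] and [k], so it maps the
    permutations selecting [j] injectively into those selecting [k]; symmetry gives equality. *)
Lemma card_first_elt_eq (j k : 'I_N) : j \in U -> k \in U ->
  #|[set s | first_elt s == j]| = #|[set s | first_elt s == k]|.
Proof.
move=> Uj Uk; apply/eqP; rewrite eqn_leq.
wlog suff le : j k Uj Uk / #|[set s | first_elt s == j]|
                          <= #|[set s | first_elt s == k]|.
  by rewrite !le.
rewrite -(card_imset _ (mulgI (tperm j k))); apply: subset_leq_card.
apply/subsetP=> _ /imsetP[s + ->]; rewrite !inE => /eqP.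
by move/(first_elt_tperm Uj Uk)/eqP.
Qed.

Lemma card_first_elt_in (W : {set 'I_N}) : W \subset U ->
  #|[set s | first_elt s \in W]| = #|W| * #|[set s | first_elt s == j0]|.
Proof.
move=> sWU; rewrite -sum1_card (partition_big first_elt (mem W)) /=; last first.
  by move=> s; rewrite inE.
rewrite -sum_nat_const; apply: eq_bigr => j Wj.
rewrite -(card_first_elt_eq (subsetP sWU j Wj) Uj0) -sum1_card.
apply: eq_bigl => s; rewrite !inE.
by case: eqP => [->|]; rewrite ?Wj // andbF.
Qed.

(** Division-free form of the probability [#|W| / #|U|]: all fibres of [first_elt] over [U] have
    equal size, and those over the whole of [U] exhaust ['S_N]. *)
Lemma card_first_elt_mul (W : {set 'I_N}) : W \subset U ->
  #|[set s | first_elt s \in W]| * #|U| = #|W| * #|'S_N|.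
Proof.
move=> sWU; have -> : #|'S_N| = #|[set s | first_elt s \in U]|.
  by rewrite -cardsT; apply: eq_card => s; rewrite !inE first_elt_in.
by rewrite !card_first_elt_in // mulnAC mulnA.
Qed.

End CollisionCount.

(** * Collisions of minwise hashes *)

Section MinHash.
Local Open Scope nat_scope.
Variables (N : nat).

Lemma minhash_le (s : 'S_N) (z : N.-tuple bool) (j : 'I_N) :
  j \in support_set z -> minhash s z <= s j.
Proof.
rewrite /minhash => zj; elim: index_enum (mem_index_enum j) => // i r IHr.
rewrite inE big_cons => /predU1P[<-|/IHr le_r]; first by rewrite zj geq_minl.
by case: ifP => // _; rewrite geq_min le_r orbT.
Qed.

Lemma minhash_attained (s : 'S_N) (z : N.-tuple bool) :
  support_set z != set0 -> exists2 j, j \in support_set z & minhash s z = s j.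
Proof.
case/set0Pn=> j0 zj0; have [j zj jmin] := arg_minnP (fun i => s i : nat) zj0.
exists j => //; apply/eqP; rewrite eqn_leq minhash_le //=.
(* The invariant is that [s j] is a lower bound; the default [N] satisfies it because ranks are
   below [N]. *)
rewrite /minhash; elim/big_ind: _ => [|m n lem len|i zi]; last exact: jmin.
  exact: ltnW.
by rewrite leq_min lem.
Qed.

Lemma minhash_collision (s : 'S_N) (y z : N.-tuple bool) (j0 : 'I_N)
    (A := support_set y) (B := support_set z) : A != set0 -> B != set0 ->
  j0 \in A :|: B ->
  (minhash s y == minhash s z) = (first_elt (A :|: B) j0 s \in A :&: B).
Proof.
move=> A0 B0 Uj0; set k := first_elt _ _ _.
have [[i Ai Ei] [j Bj Ej]] := (minhash_attained s A0, minhash_attained s B0).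
have kmin l : l \in A :|: B -> s k <= s l by apply: first_elt_le.
apply/eqP/idP => [|/setIP[Ak Bk]].
  (* Equal hashes have equal minimisers, so [i] lies in both sets; its rank is minimal on each,
     hence on the union, and so [i] is [k]. *)
  rewrite Ei Ej => /val_inj/perm_inj eq_ij; rewrite -eq_ij in Bj.
  suff <- : i = k by rewrite inE Ai.
  apply: (@perm_inj _ s); apply: val_inj; apply/eqP.
  have ki : s k <= s i by apply: kmin; rewrite inE Ai.
  rewrite eqn_leq ki andbT /=.
  have /setUP[Ak|Bk] : k \in A :|: B by apply: first_elt_in.
    by rewrite -Ei minhash_le.
  by rewrite eq_ij -Ej minhash_le.
(* Conversely, a minimiser of the union that lies in both sets is the minimiser of each. *)
have minE (w : N.-tuple bool) : k \in support_set w -> support_set w \subset A :|: B ->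
    minhash s w = s k.
  move=> wk /subsetP sw; apply/eqP; rewrite eqn_leq minhash_le //=.
  have [|l wl ->] := @minhash_attained s w; first by apply/set0Pn; exists k.
  by apply: kmin; apply: sw.
by rewrite !minE ?subsetUl ?subsetUr.
Qed.

Lemma card_minhash_collision (y z : N.-tuple bool)
    (A := support_set y) (B := support_set z) : A != set0 -> B != set0 ->
  #|[set s : 'S_N | minhash s y == minhash s z]| * #|A :|: B|
    = #|A :&: B| * #|'S_N|.
Proof.
move=> A0 B0; have [j0 Aj0] := set0Pn _ A0.
have Uj0 : j0 \in A :|: B by rewrite inE Aj0.
have sIU : A :&: B \subset A :|: B by rewrite subIset ?subsetUl.
rewrite -(card_first_elt_mul Uj0 sIU); congr (_ * _).
by apply: eq_card => s; rewrite !inE (@minhash_collision _ _ _ j0) // !inE.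
Qed.

End MinHash.

(** * Sizes and intersection of the transformed sets *)

Section Supports.
Local Open Scope nat_scope.

(** Counting over a zip lets the inner product split along concatenated blocks. *)
Lemma binary_innerE (N : nat) (y z : N.-tuple bool) :
  binary_inner y z = count (fun p => p.1 && p.2) (zip y z).
Proof.
rewrite -sum1_count (big_nth (false, false)) size_zip !size_tuple minnn.
rewrite big_mkord [RHS]big_mkcond; apply: eq_bigr => i _.
rewrite nth_zip ?size_tuple //= -!tnth_nth.
by case: (tnth y i); case: (tnth z i).
Qed.

Lemma card_support_set (N : nat) (z : N.-tuple bool) :
  #|support_set z| = nnz z.
Proof.
rewrite /nnz -sum1_count big_tuple -sum1_card.
by apply: eq_bigl => i; rewrite inE.
Qed.

Lemma card_support_setI (N : nat) (y z : N.-tuple bool) :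
  #|support_set y :&: support_set z| = binary_inner y z.
Proof.
rewrite -sum1_card big_mkcond; apply: eq_bigr => i _; rewrite !inE.
by case: (tnth y i); case: (tnth z i).
Qed.

Lemma nnz_preproc (D M : nat) (x : sparse_vec D M) : nnz (preproc x) = M.
Proof.
rewrite /nnz /= !count_cat !count_nseq /= -/(nnz (vec x)).
by have := valP x; rewrite /vec; lia.
Qed.

Lemma nnz_query_transf (D M : nat) (q : sparse_vec D M) :
  nnz (query_transf q) = M.
Proof.
rewrite /nnz /= !count_cat !count_nseq /= -/(nnz (vec q)).
by have := valP q; rewrite /vec; lia.
Qed.

Lemma count_zip_nseq_falsel (n : nat) (s : seq bool) :
  count (fun p => p.1 && p.2) (zip (nseq n false) s) = 0.
Proof. by elim: n s => [|n IHn] [|b s] //=; rewrite IHn. Qed.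

Lemma count_zip_nseq_falser (n : nat) (s : seq bool) :
  count (fun p => p.1 && p.2) (zip s (nseq n false)) = 0.
Proof. by elim: n s => [|n IHn] [|b s] //=; rewrite IHn andbF. Qed.

Lemma binary_inner_transf (D M : nat) (q x : sparse_vec D M) :
  binary_inner (query_transf q) (preproc x) = binary_inner (vec q) (vec x).
Proof.
rewrite !binary_innerE /= zip_cat ?size_tuple // count_cat.
(* Regrouping the tail of [preproc x] into two blocks of length [M] aligns its ones with the [M]
   zeros of the query, and its last [M] zeros with the query's padding ones. *)
rewrite (addnC M) nseqD [_ ++ _ ++ nseq M false]catA.
have lexM : nnz (vec x) <= M := valP x.
rewrite zip_cat ?count_cat ?size_cat ?size_nseq ?subnK //.
by rewrite count_zip_nseq_falsel count_zip_nseq_falser !addn0.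
Qed.

End Supports.

(** * Collision probability and its monotonicity *)

Lemma uniform_pr_collision (R : realFieldType) (D M : nat) (hM : (0 < M)%N)
    (q x : sparse_vec D M) (a := binary_inner (vec q) (vec x)) :
  (a <= M)%N /\
  uniform_pr R [set s : 'S_(D + 2 * M) |
                 minhash s (query_transf q) == minhash s (preproc x)]
    = a%:R / (2 * M%:R - a%:R).
Proof.
set A := support_set (query_transf q); set B := support_set (preproc x).
have cA : #|A| = M by rewrite card_support_set nnz_query_transf.
have cB : #|B| = M by rewrite card_support_set nnz_preproc.
have cI : #|A :&: B| = a by rewrite card_support_setI binary_inner_transf.
have leaM : (a <= M)%N
  by have := subset_leq_card (subsetIl A B); rewrite cA cI.
have cU : #|A :|: B| = (2 * M - a)%N by rewrite cardsU cA cB cI mul2n addnn.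
have A0 : A != set0 by rewrite -card_gt0 cA.
have B0 : B != set0 by rewrite -card_gt0 cB.
split=> //; have := card_minhash_collision A0 B0.
rewrite -/A -/B cI cU => /(congr1 (fun n => n%:R : R)); rewrite !natrM => Ecard.
have lea2M : (a <= 2 * M)%N by lia.
have U0 : 2 * M%:R - a%:R != 0 :> R.
  by rewrite -natrM -natrB // pnatr_eq0; lia.
have S0 : #|'S_(D + 2 * M)|%:R != 0 :> R.
  by rewrite pnatr_eq0 -lt0n; apply/card_gt0P; exists 1%g.
rewrite natrB // natrM in Ecard.
by apply/eqP; rewrite /uniform_pr eqr_div // Ecard.
Qed.

(** The bounds by [m] make both denominators positive; after cross-multiplication the terms in
    [a * b] cancel, leaving [2 * m * a <= 2 * m * b]. *)
Lemma jaccard_le (R : realFieldType) (m a b : R) :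
  0 < m -> a <= m -> b <= m -> a <= b -> a / (2 * m - a) <= b / (2 * m - b).
Proof.
move=> m0 am bm ab.
rewrite ler_pdivrMr; last lra.
rewrite mulrAC ler_pdivlMr; last lra.
nra.
Qed.

Unset Implicit Arguments.

Theorem theorem3 (R : realFieldType) (D M : nat) (hD : (0 < D)%N) (hM : (0 < M)%N)
    (C : {set sparse_vec D M}) (hC : C != set0)
    (S0 c : R) (hS0 : 0 < S0) (hS0M : S0 <= M%:R) (hc0 : 0 < c) (hc1 : c < 1) :
  asymmetric_sensitive
    (fun q x : sparse_vec D M => (binary_inner (vec q) (vec x))%:R)
    (fun pi : 'S_(D + 2 * M) => minhash pi)
    (@query_transf D M) (@preproc D M) C
    S0 (c * S0)
    (S0 / (2 * M%:R - S0)) (c * S0 / (2 * M%:R - c * S0)).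
Proof.
move=> q x _; have [leaM] := uniform_pr_collision R hM q x.
move=> /= ->; have m0 : 0 < M%:R :> R by rewrite ltr0n.
have am : (binary_inner (vec q) (vec x))%:R <= M%:R :> R by rewrite ler_nat.
have cS0M : c * S0 <= M%:R by nra.
(* Both claims compare the inner product with a threshold, [S0] or [c * S0], each at most [M]. *)
by split=> ?; apply: jaccard_le.
Qed.
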